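(* Let $G$ be a connected simple graph of order $n\geq 2$ and size $m\geq 1$, let $S\subseteq V(G)$ with $|S|=\sigma$, and let $G_S$ be the self-loop graph obtained from $G$ by attaching one loop at each vertex of $S$. Then the number of closed walks of length $4$ in $G_S$ is \[ w_4^{cl}(G_S)=\sigma+2\big(M_1(G)-m\big)+6\sum_{v\in S}d_G(v)-2\sum_{v\in S}n_1(v) +8\big(n_{\triangle_1}(G_S)+2n_{\triangle_2}(G_S)+3n_{\triangle_3}(G_S)+n_\square(G)+3n_\boxtimes(G)\big), \] where $M_1(G)=\sum_{v\in V(G)}d_G(v)^2$ is the first Zagreb index of $G$.
   Context: A self-loop graph $G_S$ is obtained from a simple graph $G$ by attaching exactly one loop at each vertex of $S\subseteq V(G)$. A walk of length $k$ in $G_S$ is a sequence of (not necessarily distinct) vertices $v_0,\dots,v_k$ such that for each $i$, either $v_{i-1}v_i\in E(G)$, or $v_{i-1}=v_i\in S$ (traversing the loop); it is closed if $v_k=v_0$, and $w_k^{cl}(G_S)$ is the number of closed walks of length $k$ (equivalently, the trace of $A(G_S)^k$, with $A(G_S)$ the adjacency matrix of $G$ with diagonal entry $1$ at vertices of $S$). $d_G(v)$ is the degree of $v$ in $G$. For $v\in S$, $n_1(v)$ is the number of neighbours of $v$ in $G$ that are not in $S$. For $r=1,2,3$, $n_{\triangle_r}(G_S)$ is the number of triangles of $G$ having exactly $r$ vertices in $S$ and $3-r$ vertices in $V(G)\setminus S$. $n_\boxtimes(G)$ is the number of complete subgraphs $K_4$ in $G$, and $n_\square(G)$ is the number of $4$-cycles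 $C_4$ in $G$ that are not contained in a $K_4$ of $G$ (i.e., the $4$-cycles lying in some $K_4$ are not counted in $n_\square$; they are accounted for by $n_\boxtimes$). *)

(* Defs.v *)
From mathcomp Require Import all_boot all_order all_algebra.

Set Implicit Arguments.
Unset Strict Implicit.
Unset Printing Implicit Defensive.

(* A finite simple graph is a symmetric irreflexive relation [e] (adjacency)
   on a finite type [T] of vertices.  The self-loop graph G_S is given by [e]
   together with the set [S] of the vertices that carry a loop. *)

Definition simple_graph (T : finType) (e : rel T) : Prop :=
  symmetric e /\ irreflexive e.

Definition connected_graph (T : finType) (e : rel T) : Prop :=
  forall u v : T, connect e u v.

Definition nbhd (T : finType) (e : rel T) (v : T) : {set T} :=
  [set u | e v u].

Definition deg (T : finType) (e : rel T) (v : T) : nat := #|nbhd e v|.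

Definition edges (T : finType) (e : rel T) : {set {set T}} :=
  [set [set p.1; p.2] | p : T * T & e p.1 p.2].

Definition graph_size (T : finType) (e : rel T) : nat := #|edges e|.

Definition zagreb1 (T : finType) (e : rel T) : nat := \sum_(v : T) deg e v ^ 2.

Definition loop_adj (T : finType) (e : rel T) (S : {set T}) : rel T :=
  fun u v => e u v || (u == v) && (u \in S).

(* A walk of length k is its sequence v_0, ..., v_k of k.+1 vertices, so that
   closed walks differing only in their starting point are distinct. *)
Definition closed_walks (T : finType) (e : rel T) (S : {set T}) (k : nat) :
    {set k.+1.-tuple T} :=
  [set w : k.+1.-tuple T | path (loop_adj e S) (thead w) (behead w)
                         & last (thead w) (behead w) == thead w].

Definition wcl (T : finType) (e : rel T) (S : {set T}) (k : nat) : nat :=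
  #|closed_walks e S k|.

Definition n1 (T : finType) (e : rel T) (S : {set T}) (v : T) : nat :=
  #|nbhd e v :\: S|.

(* A complete subgraph K_r is identified with its set of r vertices. *)
Definition cliques (T : finType) (e : rel T) (r : nat) : {set {set T}} :=
  [set K : {set T} | #|K| == r
     & [forall x in K, forall y in K, (x != y) ==> e x y]].

Definition n_triangle (T : finType) (e : rel T) (S : {set T}) (r : nat) : nat :=
  #|[set K in cliques e 3 | (#|K :&: S| == r) && (#|K :\: S| == 3 - r)]|.

Definition n_K4 (T : finType) (e : rel T) : nat := #|cliques e 4|.

(* A 4-cycle is a subgraph, not necessarily induced, identified with its set
   of four edges; the eight ways of running through it give the same set. *)
Definition cycle4 (T : finType) (a b c d : T) : {set {set T}} :=
  [set [set a; b]; [set b; c]; [set c; d]; [set d; a]].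

Definition C4s (T : finType) (e : rel T) : {set {set {set T}}} :=
  [set C : {set {set T}} | [exists a, exists b, exists c, exists d,
     [&& uniq [:: a; b; c; d], cycle e [:: a; b; c; d]
       & C == cycle4 a b c d]]].

(* [cover C] is the vertex set of the 4-cycle [C]. *)
Definition n_square (T : finType) (e : rel T) : nat :=
  #|[set C in C4s e | ~~ [exists K in cliques e 4, cover C \subset K]]|.

(* Main.v *)
Require Import Defs.
From mathcomp Require Import all_boot all_order all_algebra.
From mathcomp Require Import zify ring.

Set Implicit Arguments.
Unset Strict Implicit.
Unset Printing Implicit Defensive.

(* A closed 4-walk is a pair of 2-walks with common endpoints a and c, so their
   number is the sum over (a, c) of the squared number of 2-walks from a to c in
   G_S.  That number is p(a,c) + [ac edge](s_a + s_c) + [a = c] s_a, where p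
   counts 2-walks in G and s is the indicator of S; expanding the square gives
   the loop, degree and triangle terms and leaves the closed 4-walks
   (a, b, c, d) of G.  By inclusion-exclusion on the degeneracies a = c and
   b = d these contribute 2 M_1 - 2m plus the genuine 4-cycles, each of which is
   run through in 8 ways; a K4 contains 3 of them, because 4! = 8 * 3. *)

(** * Sums over tuples, and orderings of a finite set *)

Section TupleSums.
Variable T : finType.

Lemma sum_tuple0 (F : 0.-tuple T -> nat) : \sum_(t : 0.-tuple T) F t = F [tuple].
Proof. by rewrite (big_pred1 [tuple]) // => t; apply/esym/eqP; exact: tuple0. Qed.

Lemma sum_tupleS k (F : k.+1.-tuple T -> nat) :
  \sum_(t : k.+1.-tuple T) F t
  = \sum_(x : T) \sum_(t : k.-tuple T) F [tuple of x :: t].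
Proof.
rewrite pair_big /= (reindex (fun p : T * k.-tuple T => [tuple of p.1 :: p.2])) //.
exists (fun t => (thead t, [tuple of behead t])) => [[x t] _ | t _] /=.
  by rewrite theadE; congr pair; apply: val_inj.
by rewrite -tuple_eta.
Qed.

(** With only [r] entries to cover [r] elements, such a tuple repeats nothing, so it is a
    permutation of [K]. *)
Lemma card_tuple_enum r (K : {set T}) : #|K| = r ->
  #|[set t : r.-tuple T | [set x in t] == K]| = r`!.
Proof.
move=> cardK; rewrite -ffactnn -[X in X ^_ _]cardK -card_uniq_tuples.
apply: eq_card => t; rewrite !inE; apply/idP/andP => [/eqP defK | [/allP tK t_uniq]].
  split.
    by apply/allP=> x xt; have: x \in K by rewrite -defK inE.
  by apply/card_uniqP; rewrite size_tuple -[RHS]cardK -defK cardsE.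
rewrite eqEcard cardK cardsE (card_uniqP t_uniq) size_tuple leqnn.
by rewrite andbT; apply/subsetP=> x; rewrite inE => /tK.
Qed.

End TupleSums.

(** * Cliques counted through their orderings *)

Section Cliques.
Variables (T : finType) (e : rel T).
Hypotheses (e_sym : symmetric e) (e_irr : irreflexive e).

(** Irreflexivity lets [pairwise e t] also force distinct entries, hence the right cardinality. *)
Lemma mem_cliques_tuple r (t : r.-tuple T) :
  ([set x in t] \in cliques e r) = pairwise e t.
Proof.
(* [pairwise] compares entries only in order of position; the reflexive symmetric [r'] makes this
   agree with the unordered condition in [cliques]. *)
pose r' := [rel x y : T | (x != y) ==> e x y].
have r'_refl : reflexive r' by move=> x; rewrite /= eqxx.
have r'_sym : symmetric r' by move=> x y; rewrite /= eq_sym e_sym.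
rewrite inE cardsE -[X in _ == X](size_tuple t).
have -> : (#|t| == size t) = uniq t by apply/eqP/idP => /card_uniqP.
have -> : [forall x in [set x in t], forall y in [set x in t], (x != y) ==> e x y]
          = pairwise r' t.
  rewrite (pairwise_all2rel r'_refl r'_sym).
  apply/forall_inP/allrelP => [H x y xt yt | H x].
    by apply: (forall_inP (H x _)); rewrite inE.
  by rewrite inE => xt; apply/forall_inP=> y; rewrite inE => yt; apply: H.
rewrite uniq_pairwise -pairwise_relI; apply: eq_pairwise => x y /=.
by case: eqVneq => [->|]; rewrite ?e_irr.
Qed.

(** Grouping the tuples by their set of entries puts [r]! of them over each clique. Edges, triangles
    and K4s are the cases [r] = 2, 3, 4. *)
Lemma sum_pairwise_tuples r (F : {set T} -> nat) :
  \sum_(t : r.-tuple T | pairwise e t) F [set x in t]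
  = r`! * \sum_(K in cliques e r) F K.
Proof.
rewrite (partition_big (fun t : r.-tuple T => [set x in t]) (mem (cliques e r))) /=;
  last by move=> t; rewrite mem_cliques_tuple.
rewrite big_distrr /=; apply: eq_bigr => K Kcl.
rewrite -(@card_tuple_enum _ r K); last by move: Kcl; rewrite inE => /andP[/eqP].
rewrite -sum_nat_const; apply: eq_big => [t | t /andP[_ /eqP-> //]].
by rewrite inE; case: eqP => [defK|]; rewrite ?andbF // -mem_cliques_tuple defK Kcl.
Qed.

Lemma edges_cliques : edges e = cliques e 2.
Proof.
apply/setP=> E; apply/imsetP/idP => [[[x y]] /= | Ecl].
  rewrite inE /= => exy ->.
  have -> : [set x; y] = [set z in [tuple x; y]] by apply/setP=> z; rewrite !inE.
  by rewrite mem_cliques_tuple /= exy.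
have /cards2P [x [y [neq_xy defE]]] : #|E| == 2 by move: Ecl; rewrite inE => /andP[].
exists (x, y) => //; rewrite inE /=.
move: Ecl; rewrite inE => /andP[_ /forall_inP/(_ x)].
rewrite defE !inE eqxx => /(_ isT) /forall_inP/(_ y).
by rewrite !inE eqxx orbT neq_xy => /(_ isT).
Qed.

Lemma degE v : deg e v = \sum_u e v u.
Proof. by rewrite /deg -sum1dep_card big_mkcond. Qed.

Lemma handshake : \sum_v deg e v = 2 * graph_size e.
Proof.
rewrite /graph_size edges_cliques -sum1_card -(@sum_pairwise_tuples 2 (fun=> 1)).
rewrite [RHS]big_mkcond sum_tupleS; apply: eq_bigr => u _.
rewrite sum_tupleS degE; apply: eq_bigr => v _.
by rewrite sum_tuple0 /= !andbT; case: (e u v).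
Qed.

End Cliques.

(** * 4-cycles as edge sets, and their dihedral symmetry *)

Section FourCycles.
Variable T : finType.
Implicit Types a b c d x y : T.

Lemma eq_set2 x y a b :
  ([set x; y] == [set a; b]) = (x == a) && (y == b) || (x == b) && (y == a).
Proof.
apply/eqP/orP => [E | [] /andP[/eqP-> /eqP->] //]; last by rewrite setUC.
have /set2P xE : x \in [set a; b] by rewrite -E set21.
have /set2P yE : y \in [set a; b] by rewrite -E set22.
have /set2P aE : a \in [set x; y] by rewrite E set21.
have /set2P bE : b \in [set x; y] by rewrite E set22.
case: xE yE aE bE => -> [] -> [] E1 [] E2; rewrite ?E1 ?E2 ?eqxx; auto.
Qed.

Lemma cycle4_rot a b c d : cycle4 b c d a = cycle4 a b c d.
Proof. by apply/setP=> E; rewrite !inE; do 4!case: (E == _). Qed.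

Lemma cycle4_rev a b c d : cycle4 d c b a = cycle4 a b c d.
Proof.
have setC2 x y : [set x; y] = [set y; x] := setUC _ _.
rewrite /cycle4 (setC2 d c) (setC2 c b) (setC2 b a) (setC2 a d).
by apply/setP=> E; rewrite !inE; do 4!case: (E == _).
Qed.

Lemma cover_cycle4 a b c d : cover (cycle4 a b c d) = [set x in [:: a; b; c; d]].
Proof.
apply/setP=> x; rewrite /cover !inE; apply/bigcupP/idP => [[E] | ].
  by rewrite !inE -!orbA => /or4P[]/eqP-> /set2P[]->; rewrite eqxx ?orbT.
case/or4P=> /eqP->.
- by exists [set a; b]; rewrite !inE eqxx.
- by exists [set b; c]; rewrite !inE eqxx ?orbT.
- by exists [set c; d]; rewrite !inE eqxx ?orbT.
- by exists [set d; a]; rewrite !inE eqxx ?orbT.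
Qed.

(** The orbit of (a, b, c, d) under the dihedral group of order 8: four rotations, then the four
    rotations of the reversed sequence. *)
Definition dihedral4 a b c d : seq (seq T) :=
  [:: [:: a; b; c; d]; [:: b; c; d; a]; [:: c; d; a; b]; [:: d; a; b; c];
      [:: d; c; b; a]; [:: c; b; a; d]; [:: b; a; d; c]; [:: a; d; c; b]].

(** An oriented first edge determines the whole traversal: z must be the other neighbour of y on the
    cycle, and t the other neighbour of z. *)
Lemma cycle4_inj a b c d x y z t :
    uniq [:: a; b; c; d] -> uniq [:: x; y; z; t] ->
  (cycle4 x y z t == cycle4 a b c d) = ([:: x; y; z; t] \in dihedral4 a b c d).
Proof.
move=> U V; apply/eqP/idP => [E | ]; last first.
  have r1 := cycle4_rot a b c d; have r2 := cycle4_rot b c d a.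
  have r3 := cycle4_rot c d a b; have rv := cycle4_rev a b c d.
  have v1 := cycle4_rot c b a d; have v2 := cycle4_rot b a d c.
  have v3 := cycle4_rot a d c b.
  by rewrite /dihedral4 !inE !eqseq_cons; do 7 ?case/orP;
    case/and4P=> /eqP-> /eqP-> /eqP-> /andP[/eqP-> _]; congruence.
have Exy : [set x; y] \in cycle4 a b c d by rewrite -E !inE eqxx.
have Eyz : [set y; z] \in cycle4 a b c d by rewrite -E !inE eqxx ?orbT.
have Ezt : [set z; t] \in cycle4 a b c d by rewrite -E !inE eqxx ?orbT.
move: U; rewrite /= !inE !negb_or -!andbA !andbT.
case/and5P=> /negbTE ab /negbTE ac /negbTE ad /negbTE bc /andP[/negbTE bd /negbTE cd].
have neqE := (eqxx, ab, ac, ad, bc, bd, cd, (eq_sym b a, eq_sym c a, eq_sym d a,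
              eq_sym c b, eq_sym d b, eq_sym d c)).
(* These inequalities forbid turning back along the edge just used. *)
have [xz yt] : (x == z) = false /\ (y == t) = false.
  by move: V; rewrite /= !inE !negb_or -!andbA => /and5P[_ /negbTE-> _ _ /andP[/negbTE->]].
move: Exy; rewrite !inE !eq_set2 -!orbA => H.
(* Eight cases for the first step: four edges, each with two orientations. *)
do 7 ?[case/orP: H => H]; case/andP: H => /eqP ? /eqP ?; subst x y;
  move: Eyz; rewrite !inE !eq_set2 !neqE ?andbF /= ?orbF => H;
  do ?[case/orP: H => H]; move/eqP: H => ?; subst z; rewrite ?eqxx // in xz;
  move: Ezt; rewrite !inE !eq_set2 !neqE ?andbF /= ?orbF => H;
  do ?[case/orP: H => H]; move/eqP: H => ?; subst t; rewrite ?eqxx // in yt;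
  by rewrite ?eqxx ?orbT.
Qed.

End FourCycles.

(** * Counting 4-cycles through their traversals *)

Section CountFourCycles.
Variables (T : finType) (e : rel T).
Hypotheses (e_sym : symmetric e) (e_irr : irreflexive e).

Lemma tuple4_eta (t : 4.-tuple T) : exists a b c d, t = [tuple a; b; c; d].
Proof.
case/tupleP: t => a; case/tupleP=> b; case/tupleP=> c; case/tupleP=> d t.
by exists a, b, c, d; apply: val_inj; rewrite (tuple0 t).
Qed.

(** [thead t] is only the default value of [nth]; the indices stay below 4. *)
Definition tuple_cycle4 (t : 4.-tuple T) : {set {set T}} :=
  let x := nth (thead t) t in cycle4 (x 0) (x 1) (x 2) (x 3).

Lemma card_dihedral4 a b c d : uniq [:: a; b; c; d] ->
  #|[set t : 4.-tuple T | tval t \in dihedral4 a b c d]| = 8.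
Proof.
move=> U; pose s : seq (4.-tuple T) :=
  [:: [tuple a; b; c; d]; [tuple b; c; d; a]; [tuple c; d; a; b]; [tuple d; a; b; c];
      [tuple d; c; b; a]; [tuple c; b; a; d]; [tuple b; a; d; c]; [tuple a; d; c; b]].
have -> : dihedral4 a b c d = map val s by [].
suff s_uniq : uniq s.
  rewrite -[RHS](card_uniqP s_uniq); apply: eq_card => t.
  by rewrite inE mem_map //; apply: val_inj.
rewrite -(map_inj_uniq val_inj) /= !inE !eqseq_cons.
move: U; rewrite /= !inE !negb_or -!andbA !andbT.
case/and5P=> /negbTE ab /negbTE ac /negbTE ad /negbTE bc /andP[/negbTE bd /negbTE cd].
by rewrite !(ab, ac, ad, bc, bd, cd, eq_sym b a, eq_sym c a, eq_sym d a,
             eq_sym c b, eq_sym d b, eq_sym d c, andbF).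
Qed.

(** The fibre of [tuple_cycle4] over a 4-cycle is one dihedral orbit, of size 8. *)
Lemma sum_cycle4_tuples (F : {set {set T}} -> nat) :
  \sum_(t : 4.-tuple T | uniq t && cycle e t) F (tuple_cycle4 t)
  = 8 * \sum_(C in C4s e) F C.
Proof.
rewrite (partition_big tuple_cycle4 (mem (C4s e))) /=; last first.
  move=> t; have [a [b [c [d ->]]]] := tuple4_eta t; case/andP=> U C; rewrite inE.
  apply/existsP; exists a; apply/existsP; exists b; apply/existsP; exists c.
  by apply/existsP; exists d; apply/and3P.
rewrite big_distrr /=; apply: eq_bigr => C.
rewrite inE => /existsP[a /existsP[b /existsP[c /existsP[d /and3P[U]]]]].
rewrite /= andbT => /and4P[eab ebc ecd eda] /eqP defC.
rewrite -(card_dihedral4 U) -sum_nat_const; apply: eq_big => [t | t /andP[_ /eqP-> //]].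
rewrite inE; have [x [y [z [u ->]]]] := tuple4_eta t.
rewrite [tuple_cycle4 _]/(cycle4 x y z u).
(* [cycle4_inj] needs distinct entries, so repetitions are excluded first: every sequence in the
   orbit permutes the distinct a, b, c, d. *)
have [V | nV] := boolP (uniq [:: x; y; z; u]); last first.
  apply/esym/negbTE; apply: contra nV => /=; rewrite /dihedral4 !inE !eqseq_cons.
  move: U; rewrite /= !inE !negb_or -!andbA !andbT.
  case/and5P=> /negbTE ab /negbTE ac /negbTE ad /negbTE bc /andP[/negbTE bd /negbTE cd].
  do 7 ?case/orP; case/and4P=> /eqP-> /eqP-> /eqP-> /eqP->;
  by rewrite !(ab, ac, ad, bc, bd, cd, eq_sym b a, eq_sym c a, eq_sym d a,
             eq_sym c b, eq_sym d b, eq_sym d c).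
rewrite defC [RHS](esym (cycle4_inj U V)) andTb.
case E: (cycle4 x y z u == _); rewrite ?andbF // andbT.
move: E; rewrite (cycle4_inj U V) /dihedral4 !inE !eqseq_cons.
have [eba ecb edc ead] : [/\ e b a, e c b, e d c & e a d] by split; rewrite e_sym.
by do 7 ?case/orP; case/and4P=> /eqP-> /eqP-> /eqP-> /andP[/eqP-> _];
  apply/and4P; split => //; apply/andP; split.
Qed.

(** The four distinct vertices of the cycle fill any 4-clique that contains them. *)
Lemma cover_in_clique4 a b c d : uniq [:: a; b; c; d] ->
  [exists K in cliques e 4, cover (cycle4 a b c d) \subset K]
  = pairwise e [:: a; b; c; d].
Proof.
move=> U; rewrite cover_cycle4 -(mem_cliques_tuple e_sym e_irr [tuple a; b; c; d]).
apply/exists_inP/idP => [[K Kcl sK] | Kcl]; last by eexists; first exact: Kcl.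
suff -> : [set x in [tuple a; b; c; d]] = K by [].
apply/eqP; rewrite eqEcard sK cardsE (card_uniqP U).
by move: Kcl; rewrite inE => /andP[/eqP->].
Qed.

Lemma card_C4s : #|C4s e| = n_square e + 3 * n_K4 e.
Proof.
pose Q (C : {set {set T}}) := [exists K in cliques e 4, cover C \subset K].
have -> : #|C4s e| = n_square e + \sum_(C in C4s e) Q C.
  rewrite /n_square -[#|[set C in _ | _]|]sum1dep_card -sum1_card.
  rewrite big_mkcondr /= -big_split /=; apply: eq_bigr => C _.
  by rewrite -/(Q C); case: (Q C).
(* After multiplication by 8, both sides count 4-tuples of pairwise adjacent vertices: as traversals
   of cycles inside a K4, and as the 4! = 8 * 3 orderings of each K4. *)
congr (_ + _); apply/eqP; rewrite -(eqn_pmul2l (isT : 0 < 8)) -sum_cycle4_tuples.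
rewrite mulnA -[8 * 3]/(4`!) /n_K4 -sum1_card.
rewrite -(@sum_pairwise_tuples _ _ e_sym e_irr 4 (fun=> 1)).
rewrite big_mkcond [X in _ == X]big_mkcond; apply/eqP; apply: eq_bigr.
move=> t _; have [a [b [c [d ->]]]] := tuple4_eta t.
rewrite [tuple_cycle4 _]/(cycle4 a b c d) /Q.
have [U | nU] := boolP (uniq [:: a; b; c; d]).
  rewrite (cover_in_clique4 U) /=; rewrite (e_sym d a).
  by case: (e a b) (e b c) (e c d) (e a d) => [] [] [] [] /=;
    rewrite ?andbF //= andbT; case: ifP.
rewrite [RHS]ifF //; apply: contraNF nU; rewrite uniq_pairwise.
by apply: sub_pairwise => x y; apply: contraTneq => ->; rewrite e_irr.
Qed.

End CountFourCycles.

(** * Expansion of the closed 4-walk count *)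

Section ClosedWalks.
Variables (T : finType) (e : rel T) (S : {set T}).
Hypotheses (e_sym : symmetric e) (e_irr : irreflexive e).

(** Over [nat], [L] is the adjacency matrix of G_S and [P2] is the square of that of G. *)
Let s (u : T) : nat := u \in S.
Let L (u v : T) : nat := loop_adj e S u v.
Let P2 (u v : T) : nat := \sum_w e u w * e w v.

Lemma sum_delta (a : T) (F : T -> nat) : \sum_b (a == b) * F b = F a.
Proof.
rewrite (bigD1 a) //= eqxx mul1n big1 ?addn0 // => b.
by rewrite eq_sym => /negbTE->.
Qed.

Lemma wcl4_sum :
  wcl e S 4 = \sum_a \sum_b \sum_c \sum_d L a b * L b c * L c d * L d a.
Proof.
rewrite /wcl -sum1_card big_mkcond.
rewrite sum_tupleS; apply: eq_bigr => a _; rewrite sum_tupleS; apply: eq_bigr => b _.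
rewrite sum_tupleS; apply: eq_bigr => c _; rewrite sum_tupleS; apply: eq_bigr => d _.
(* The fifth entry z must repeat a; a delta turns the summand into a sum over z, to be compared
   termwise. *)
rewrite sum_tupleS -(sum_delta a (fun z => L a b * L b c * L c d * L d z)).
apply: eq_bigr => z _; rewrite sum_tuple0 inE /= theadE eq_sym /L.
by rewrite !mulnb andbT andbC -!andbA; case: ifP.
Qed.

Lemma loop_adjE u v : L u v = e u v + (u == v) * s u.
Proof.
rewrite /L /loop_adj /s; case: eqVneq => [->|_]; rewrite ?e_irr ?orbF ?addn0 //.
by rewrite mul1n.
Qed.

Lemma loop_adj_sym u v : L u v = L v u.
Proof. by rewrite !loop_adjE e_sym eq_sym; case: eqVneq => [->|]. Qed.

Lemma sum_loop_walks2 a c :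
  \sum_b L a b * L b c = P2 a c + e a c * (s a + s c) + (a == c) * s a.
Proof.
(* The four kinds of 2-walk: two edges, loop then edge, edge then loop, and a loop taken twice. *)
transitivity (\sum_b (e a b * e b c + (a == b) * (s a * e b c)
    + (c == b) * (e a b * s b) + (a == b) * ((b == c) * s a * s b))).
  apply: eq_bigr => b _; rewrite !loop_adjE (eq_sym c b) mulnDl !mulnDr.
  by case: (b == c); rewrite ?muln0 ?mul0n ?mul1n ?addn0; lia.
rewrite !big_split /= !sum_delta -/(P2 a c) /s.
by case: (e a c); case: (a \in S); case: (c \in S); case: (a == c); lia.
Qed.

(** Once a and c are fixed, b and d vary independently, and symmetry of [L] makes the two factors
    equal. *)
Lemma wcl4_sqr :
  wcl e S 4 = \sum_a \sum_c (\sum_b L a b * L b c) ^ 2.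
Proof.
rewrite wcl4_sum; apply: eq_bigr => a _; rewrite exchange_big; apply: eq_bigr => c _.
rewrite -mulnn big_distrlr /=; apply: eq_bigr => b _; apply: eq_bigr => d _.
rewrite (loop_adj_sym d a) (loop_adj_sym c d) -!mulnA.
by congr (_ * (_ * _)); rewrite mulnC.
Qed.

(** Indicators are idempotent, and the product of [e a c] with [a == c] vanishes by
    irreflexivity. *)
Lemma sqr_loop_walks2 a c :
  (\sum_b L a b * L b c) ^ 2
  = P2 a c ^ 2 + e a c * s a + e a c * s c + 2 * (s a * (e a c * s c))
    + (a == c) * s c + 2 * (P2 a c * e a c * s a) + 2 * (P2 a c * e a c * s c)
    + 2 * ((a == c) * (P2 a c * s a)).
Proof.
rewrite sum_loop_walks2 /s; case: eqVneq => [<-|_]; rewrite ?e_irr.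
  by case: (a \in S) => /=; ring.
by case: (e a c); case: (a \in S); case: (c \in S) => /=; ring.
Qed.

Lemma sum_in (F : T -> nat) : \sum_a F a * s a = \sum_(a in S) F a.
Proof.
rewrite [RHS]big_mkcond; apply: eq_bigr => a _.
by rewrite /s; case: (a \in S); rewrite ?muln1 ?muln0.
Qed.

Lemma walk2_diag a : P2 a a = deg e a.
Proof. by rewrite degE; apply: eq_bigr => b _; rewrite (e_sym b a) mulnb andbb. Qed.

(** The left side counts ordered triangles starting in [S]; each looped vertex of a triangle comes
    first in two orderings. *)
Lemma sum_triangles_in :
  \sum_a \sum_c P2 a c * e a c * s a
  = 2 * (n_triangle e S 1 + 2 * n_triangle e S 2 + 3 * n_triangle e S 3).
Proof.
set N := (_ + _ + _).
(* A triangle with r looped vertices has weight r. *)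
have NE : N = \sum_(K in cliques e 3) #|K :&: S|.
  rewrite /N /n_triangle -![#|[set _ in _ | _]|]sum1dep_card !big_mkcondr /=.
  rewrite !big_distrr /= -!big_split /=; apply: eq_bigr => K.
  rewrite inE => /andP[/eqP cK _].
  have := cardsID S K; rewrite cK.
  by move: #|_ :&: _| #|_ :\: _| => [|[|[|[|i]]]] [|[|[|[|j]]]].
pose W (a b c : T) := e a b * e b c * e a c.
have Q1 : \sum_a \sum_c P2 a c * e a c * s a = \sum_a \sum_b \sum_c W a b c * s a.
  apply: eq_bigr => a _; rewrite exchange_big; apply: eq_bigr => c _ /=.
  by rewrite !big_distrl.
have Q2 : \sum_a \sum_b \sum_c W a b c * s a = \sum_a \sum_b \sum_c W a b c * s b.
  rewrite [RHS]exchange_big; apply: eq_bigr => a _; apply: eq_bigr => b _.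
  by apply: eq_bigr => c _; rewrite /W (e_sym b a); lia.
have Q3 : \sum_a \sum_b \sum_c W a b c * s b = \sum_a \sum_b \sum_c W a b c * s c.
  apply: eq_bigr => a _; rewrite [RHS]exchange_big; apply: eq_bigr => b _.
  by apply: eq_bigr => c _; rewrite /W (e_sym c b); lia.
(* By symmetry of W the three vertices contribute equally, so the sum is a third
   of the one where the whole triangle is weighted by its number of loops. *)
have : \sum_a \sum_b \sum_c W a b c * (s a + s b + s c) = 3`! * N.
  rewrite NE -(sum_pairwise_tuples e_sym e_irr) [RHS]big_mkcond.
  rewrite sum_tupleS; apply: eq_bigr => a _; rewrite sum_tupleS; apply: eq_bigr => b _.
  rewrite sum_tupleS; apply: eq_bigr => c _; rewrite sum_tuple0 /W /= !andbT.
  case: ifP => [/andP[/andP[ab ac] bc] | ]; last first.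
    by case: (e a b); case: (e a c); case: (e b c); rewrite ?muln0 ?mul0n.
  rewrite ab ac bc !mul1n.
  have U : uniq [:: a; b; c].
    by rewrite /= !inE !andbT negb_or -andbA; apply/and3P; split;
      [apply: contraTneq ab | apply: contraTneq ac | apply: contraTneq bc] => ->;
      rewrite e_irr.
  have -> : #|[set x in [tuple a; b; c]] :&: S| = count (mem S) [:: a; b; c].
    rewrite -size_filter -(card_uniqP (filter_uniq _ U)); apply: eq_card => x.
    by rewrite mem_filter !inE andbC.
  by rewrite /= addn0 addnA.
rewrite Q1.
under eq_bigr => a _ do under eq_bigr => b _ do under eq_bigr => c _ do rewrite !mulnDr.
under eq_bigr => a _ do under eq_bigr => b _ do rewrite !big_split /=.
under eq_bigr => a _ do rewrite !big_split /=.
have -> : 3`! = 6 by [].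
rewrite !big_split /= -Q3 -Q2; lia.
Qed.

(** The overlap a = c, b = d is added on the left, so inclusion-exclusion needs no truncated
    subtraction. *)
Lemma sum_walks4 :
  \sum_a \sum_c P2 a c ^ 2 + 2 * graph_size e
  = 2 * zagreb1 e + 8 * (n_square e + 3 * n_K4 e).
Proof.
pose W (a b c d : T) := e a b * e b c * e c d * e d a.
have -> : \sum_a \sum_c P2 a c ^ 2 = \sum_a \sum_b \sum_c \sum_d W a b c d.
  apply: eq_bigr => a _; rewrite [RHS]exchange_big; apply: eq_bigr => c _.
  rewrite -mulnn big_distrlr /=; apply: eq_bigr => b _; apply: eq_bigr => d _.
  by rewrite /W (e_sym d a) (e_sym c d); lia.
(* If a = c, then b and d are independent neighbours of a, giving the squared degree. *)
have sumW_ac : \sum_a \sum_b \sum_c \sum_d (a == c) * W a b c d = zagreb1 e.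
  apply: eq_bigr => a _; rewrite -mulnn degE big_distrlr /=; apply: eq_bigr => b _.
  under eq_bigr => c _ do rewrite -big_distrr /=.
  rewrite sum_delta; apply: eq_bigr => d _; rewrite /W (e_sym d a) (e_sym b a).
  by case: (e a b); case: (e a d).
have sumW_bd : \sum_a \sum_b \sum_c \sum_d (b == d) * W a b c d = zagreb1 e.
  rewrite exchange_big; apply: eq_bigr => b _; rewrite -mulnn degE big_distrlr /=.
  apply: eq_bigr => a _; apply: eq_bigr => c _; rewrite sum_delta /W (e_sym a b) (e_sym c b).
  by case: (e b a); case: (e b c).
have sumW_acbd : \sum_a \sum_b \sum_c \sum_d (a == c) * ((b == d) * W a b c d)
                    = 2 * graph_size e.
  rewrite -handshake //; apply: eq_bigr => a _; rewrite degE; apply: eq_bigr => b _.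
  under eq_bigr => c _ do rewrite -big_distrr /= sum_delta.
  by rewrite sum_delta /W (e_sym b a); case: (e a b).
rewrite -card_C4s // -sum1_card -(sum_cycle4_tuples e_sym (fun=> 1)).
rewrite [X in _ = _ + X]big_mkcond.
(* One copy of [zagreb1 e] becomes the sum for a = c, the other that for b = d, so the identity can
   be checked for each (a, b, c, d). *)
rewrite -sumW_acbd mul2n -addnn -{1}sumW_ac -sumW_bd.
rewrite [X in _ = _ + X]sum_tupleS -!big_split; apply: eq_bigr => a _ /=.
rewrite [X in _ = _ + X]sum_tupleS -!big_split; apply: eq_bigr => b _ /=.
rewrite [X in _ = _ + X]sum_tupleS -!big_split; apply: eq_bigr => c _ /=.
rewrite [X in _ = _ + X]sum_tupleS -!big_split; apply: eq_bigr => d _ /=.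
rewrite sum_tuple0 /= !inE /W.
(* Equal consecutive vertices make every term vanish, which leaves only a = c and b = d as possible
   coincidences. *)
case: (eqVneq a b) => [<-|_]; first by rewrite e_irr /= !muln0.
case: (eqVneq b c) => [<-|_]; first by rewrite e_irr /= !(muln0, andbF).
case: (eqVneq c d) => [<-|_]; first by rewrite e_irr /= !(muln0, andbF).
case: (eqVneq a d) => [<-|_]; first by rewrite e_irr /= !(muln0, andbF).
case: (a == c); case: (b == d); case: (e a b); case: (e b c); case: (e c d);
  by case: (e d a).
Qed.

(** For v in [S], the neighbours inside [S] and those counted by [n1] partition the
    neighbourhood. *)
Lemma sum_adj_in :
  \sum_a \sum_c s a * (e a c * s c) + \sum_(v in S) n1 e S v = \sum_(v in S) deg e v.
Proof.
transitivity (\sum_(v in S) (#|nbhd e v :&: S| + n1 e S v)); last first.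
  by apply: eq_bigr => v _; rewrite cardsID.
rewrite big_split /=; congr (_ + _); rewrite -sum_in; apply: eq_bigr => a _.
rewrite -big_distrr mulnC /=; congr (_ * _).
rewrite -sum1_card [RHS]big_mkcond; apply: eq_bigr => c _.
by rewrite !inE /s; case: (e a c); case: (c \in S).
Qed.

(** The coefficient 6 collects 2 from single edge terms, 2 from the diagonal cross term and 2 from
    edges inside [S], the last bringing the correction by [n1]. The triangle factor 8 is 4 cross
    terms times the 2 of [sum_triangles_in]. *)
Lemma wcl4_nat :
  wcl e S 4 + 2 * graph_size e + 2 * \sum_(v in S) n1 e S v
  = #|S| + 2 * zagreb1 e + 6 * \sum_(v in S) deg e v
    + 8 * (n_triangle e S 1 + 2 * n_triangle e S 2 + 3 * n_triangle e S 3
           + n_square e + 3 * n_K4 e).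
Proof.
have sum_deg_l : \sum_a \sum_c e a c * s a = \sum_(v in S) deg e v.
  by rewrite -sum_in; apply: eq_bigr => a _; rewrite -big_distrl degE.
have sum_deg_r : \sum_a \sum_c e a c * s c = \sum_(v in S) deg e v.
  rewrite exchange_big -sum_deg_l; apply: eq_bigr => a _; apply: eq_bigr => c _.
  by rewrite e_sym.
have sum_loops : \sum_a \sum_c (a == c) * s c = #|S|.
  under eq_bigr => a _ do rewrite sum_delta.
  by rewrite -sum1_card -sum_in; apply: eq_bigr => a _; rewrite mul1n.
have sum_diag : \sum_a \sum_c (a == c) * (P2 a c * s a) = \sum_(v in S) deg e v.
  by rewrite -sum_in; apply: eq_bigr => a _; rewrite sum_delta walk2_diag.
have sum_tri_r : \sum_a \sum_c P2 a c * e a c * s c = \sum_a \sum_c P2 a c * e a c * s a.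
  rewrite exchange_big; apply: eq_bigr => c _; apply: eq_bigr => a _.
  rewrite (e_sym a c); congr (_ * _ * _); apply: eq_bigr => b _.
  by rewrite (e_sym a b) (e_sym b c) mulnC.
(* Splitting a doubled term [2 * x] as [x + (x + 0)] leaves sums of zeros. *)
have sum0 : \sum_(a : T) \sum_(c : T) 0 = 0 by rewrite big1 // => a _; rewrite big1_eq.
rewrite wcl4_sqr.
under eq_bigr => a _ do under eq_bigr => c _ do rewrite sqr_loop_walks2.
under eq_bigr => a _ do rewrite !big_split /=.
rewrite !big_split /= sum0 sum_deg_l sum_deg_r sum_loops sum_diag sum_tri_r.
have := sum_walks4; have := sum_triangles_in; have := sum_adj_in; lia.
Qed.

End ClosedWalks.

(** * Passage from natural numbers to integers *)

Import GRing.Theory.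
Local Open Scope ring_scope.

Theorem theorem2p12 (T : finType) (e : rel T) (S : {set T}) (n m sigma : nat)
    (e_simple : simple_graph e) (e_conn : connected_graph e)
    (order_n : #|T| = n) (n_ge2 : (2 <= n)%N)
    (size_m : graph_size e = m) (m_ge1 : (1 <= m)%N)
    (card_S : #|S| = sigma) :
  (wcl e S 4)%:Z =
    sigma%:Z + 2 * ((zagreb1 e)%:Z - m%:Z)
    + 6 * (\sum_(v in S) (deg e v)%:Z) - 2 * (\sum_(v in S) (n1 e S v)%:Z)
    + 8 * ((n_triangle e S 1)%:Z + 2 * (n_triangle e S 2)%:Z
           + 3 * (n_triangle e S 3)%:Z + (n_square e)%:Z + 3 * (n_K4 e)%:Z).
Proof.
case: e_simple => e_sym e_irr; rewrite -size_m -card_S.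
have := wcl4_nat S e_sym e_irr.
(* Sums of casts are gathered into casts of sums, the atoms that occur in [wcl4_nat]. *)
rewrite -!(big_morph Posz PoszD (erefl 0%:Z)); lia.
Qed.
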